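(* Let $1\le p<\infty$, let $T$ be a tree and assume that the forward shift $S$ is bounded on $\mathbb{H}^p_0(T)$. Then $S$ is not hypercyclic on $\mathbb{H}^p_0(T)$.
   Context: $\mathbb{N}_0=\{0,1,2,\dots\}$. A tree $T$ means a connected graph with no cycles, with countably infinitely many vertices, locally finite (every vertex has finitely many adjacent vertices), with a distinguished vertex $\mathrm{o}$ called the root. For a vertex $v$, $|v|$ is the number of edges in the unique path between $\mathrm{o}$ and $v$; $v$ is in level $n$ if $|v|=n$, and $\gamma(n)$ is the number of vertices in level $n$. For $v\neq \mathrm{o}$, $\operatorname{par}(v)$ (the parent of $v$) is the unique vertex $w$ on the path from $v$ to $\mathrm{o}$ with $|w|=|v|-1$. $\mathcal{F}$ is the vector space of all complex-valued functions on the set of vertices of $T$. For $f\in\mathcal{F}$ and $n\in\mathbb{N}_0$, $M_p(n,f):=\left(\frac{1}{\gamma(n)}\sum_{|v|=n}|f(v)|^p\right)^{1/p}$. The little Hardy space $\mathbb{H}^p_0(T)$ is the set of $f\in\mathcal{F}$ with $\lim_{n\to\infty}M_p(n,f)=0$; it is a Banach space with the norm $\|f\|:=\sup_{n\in\mathbb{N}_0}M_p(n,f)$. The forward shift $S:\mathcal{F}\to\mathcal{F}$ is the linear map $(Sf)(v)=f(\operatorname{par}(v))$ if $v\neq \mathrm{o}$ and $(Sf)(\mathrm{o})=0$. ''$S$ is bounded on $\mathbb{H}^p_0(T)$'' means that $S$ maps $\mathbb{H}^p_0(T)$ into itself and is a bounded linear operator there. An operator $A$ on a Banach space $\mathcal{B}$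 is hypercyclic if there is $x\in\mathcal{B}$ whose orbit $\{x,Ax,A^2x,\dots\}$ is dense in $\mathcal{B}$. *)

(* Defs.v *)
From mathcomp Require Import all_boot all_order all_algebra.
From mathcomp Require Import finmap complex.
From mathcomp Require Import all_classical all_reals all_analysis.

Set Implicit Arguments.
Unset Strict Implicit.
Unset Printing Implicit Defensive.

Import Order.TTheory GRing.Theory Num.Theory.
Import numFieldNormedType.Exports.

Local Open Scope card_scope.
Local Open Scope fset_scope.
Local Open Scope classical_set_scope.
Local Open Scope ring_scope.
Local Open Scope complex_scope.

(* A cycle is a closed walk through at least three pairwise distinct vertices;
   size 2 has to be excluded because [:: x; y] is a [cycle] of any symmetric
   relation having x and y adjacent. *)
Record tree := Tree {
  vertex :> choiceType;
  adj : rel vertex;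
  tree_root : vertex;
  adj_sym : symmetric adj;
  adj_irr : irreflexive adj;
  tree_connected : forall x y : vertex,
    exists2 s : seq vertex, path adj x s & last x s = y;
  tree_acyclic : forall c : seq vertex, (2 < size c)%N -> ~ ucycle adj c;
  tree_countably_infinite : [set: vertex] #= [set: nat];
  tree_locally_finite : forall x : vertex, finite_set [set y | adj x y]
}.

Section Tree.
Variable T : tree.

(* As usual with [path], the initial vertex [tree_root T] is not listed in s, so
   that [size s] counts edges. *)
Definition is_root_path (v : T) (s : seq T) : Prop :=
  [/\ path (@adj T) (tree_root T) s, uniq (tree_root T :: s) & last (tree_root T) s = v].

(* The defaults of [xget] here and in [par] are never reached for, respectively,
   any v and any v other than the root. *)
Definition root_path (v : T) : seq T := xget [::] [set s | is_root_path v s].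

Definition level (v : T) : nat := size (root_path v).

Definition level_set (n : nat) : set T := [set v | level v = n].

Definition gamma (n : nat) : nat := #|` fset_set (level_set n)|.

Definition par (v : T) : T :=
  xget (tree_root T) [set w | w \in tree_root T :: root_path v /\ level w = (level v).-1].

End Tree.

Section BanachSubspace.
Variables (R : realType) (E : lmodType R[i]).

(* B is (the carrier of) a linear subspace of E, normed by the restriction of
   N to B; the values of N outside B are irrelevant. *)
Definition bounded_operator_on (B : set E) (N : E -> R) (A : E -> E) : Prop :=
  [/\ forall f, B f -> B (A f),
      forall (a : R[i]) f g, B f -> B g -> A (a *: f + g) = a *: A f + A g
    & exists C : R, forall f, B f -> N (A f) <= C * N f].

Definition hypercyclic_on (B : set E) (N : E -> R) (A : E -> E) : Prop :=
  exists2 f, B f & forall g, B g -> forall e : R, 0 < e ->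
    exists n : nat, N (iter n A f - g) < e.

End BanachSubspace.

Section Hardy.
Variables (R : realType) (T : tree).

Definition mean (p : R) (n : nat) (f : T -> R[i]) : R :=
  ((gamma T n)%:R^-1 * \sum_(v \in (level_set n : set T)) (Normc.normc (f v) `^ p))
    `^ p^-1.

Definition little_hardy (p : R) : set (T -> R[i]) :=
  [set f | mean p n f @[n --> \oo] --> (0 : R)].

(* [sup] is the real supremum, a junk value for unbounded sequences; for f in
   the little Hardy space the means converge and hence are bounded. *)
Definition hardy_norm (p : R) (f : T -> R[i]) : R :=
  sup [set mean p n f | n in [set: nat]].

Definition forward_shift (f : T -> R[i]) : T -> R[i] :=
  fun v => if v == tree_root T then 0 else f (par v).

End Hardy.

Arguments little_hardy R T p : clear implicits.
Arguments hardy_norm R T p f : clear implicits.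
Arguments forward_shift R T f v : clear implicits.

(* Main.v *)
Require Import Defs.
From mathcomp Require Import all_boot all_order all_algebra.
From mathcomp Require Import finmap complex.
From mathcomp Require Import all_classical all_reals all_analysis.

Import Order.TTheory GRing.Theory Num.Theory.
Import numFieldNormedType.Exports.

Local Open Scope ring_scope.

(** Every [S^n f] with [n >= 1] vanishes at the root [o], and evaluation at [o]
is continuous because [M_p(0, f) = |f(o)|] ([mean0]), so that
[|f(o)| <= ||f||] ([normc_root_le_hardy_norm]).  Hence, for a scalar [c] with
[1 <= |c|] and [1 <= |f(o) - c|], no element of the orbit of [f] is within
distance [1] of the function equal to [c] at [o] and to [0] elsewhere.  The
scalar [c = |f(o)| + 1] works. *)

Lemma root_path_exists (T : tree) (v : T) : exists s, is_root_path v s.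
Proof.
have [s sP sv] := tree_connected (tree_root T) v.
by case: (shortenP sP) sv => s' s'P s'U _ s'v; exists s'.
Qed.

Lemma root_pathP (T : tree) (v : T) : is_root_path v (root_path v).
Proof. exact: (xgetPex _ (root_path_exists T v)). Qed.

Lemma level_eq0 (T : tree) (v : T) : (level v == 0%N) = (v == tree_root T).
Proof.
have [_ sU sv] := root_pathP T v; rewrite /level.
case: (root_path v) sU sv => [|w s] /= sU sv; first by rewrite -sv !eqxx.
apply/esym/negbTE; apply: contraTneq sU => vo.
(* a nonempty path from the root back to the root repeats the root *)
by rewrite -{1}vo -sv mem_last.
Qed.

Lemma level_set0 (T : tree) : @level_set T 0 = [set tree_root T]%classic.
Proof.
apply/seteqP; split => v /=; rewrite /level_set /= => /eqP.
  by rewrite level_eq0 => /eqP.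
by rewrite -level_eq0 => /eqP.
Qed.

Lemma mean0 (R : realType) (T : tree) (p : R) (f : T -> R[i]) :
  p != 0 -> mean p 0 f = Normc.normc (f (tree_root T)).
Proof.
move=> p0; rewrite /mean /gamma level_set0 fset_set1 cardfs1 invr1 mul1r.
rewrite fsbig_set1 -powRrM mulfV // powRr1 //.
by case: (f _) => a b; rewrite /= sqrtr_ge0.
Qed.

Lemma mean_eq_off_root {R : realType} {T : tree} {p : R} {f g : T -> R[i]}
    (n : nat) :
  (forall v, v != tree_root T -> f v = g v) ->
  mean p n.+1 f = mean p n.+1 g.
Proof.
move=> fg; rewrite /mean; congr ((_ * _) `^ _).
apply: eq_fsbigr => v; rewrite inE /level_set /= => lv.
by rewrite fg // -level_eq0 lv.
Qed.

(** Modifying a function at the root affects only its mean over level 0, hence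
not its membership in the little Hardy space.  Applied to the difference between
an orbit element and a function supported at the root, this ensures that the
supremum defining its norm is a genuine one. *)
Lemma little_hardy_eq_off_root {R : realType} {T : tree} {p : R}
    {f g : T -> R[i]} :
  (forall v, v != tree_root T -> f v = g v) ->
  little_hardy R T p f -> little_hardy R T p g.
Proof.
rewrite /little_hardy /= => fg fH.
rewrite -(cvg_shiftS (mean p ^~ g)) /=.
have -> : (fun n => mean p n.+1 g) = (fun n => mean p n.+1 f).
  by apply/funext => n; rewrite (mean_eq_off_root n fg).
by rewrite (cvg_shiftS (mean p ^~ f)).
Qed.

Lemma mean_le_hardy_norm {R : realType} {T : tree} {p : R} {f : T -> R[i]}
    (n : nat) :
  little_hardy R T p f -> mean p n f <= hardy_norm R T p f.
Proof.
move=> fH; apply: ub_le_sup; last by exists n.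
apply: bounded_fun_has_ubound; apply: cvg_seq_bounded.
by apply/cvg_ex; exists 0.
Qed.

Lemma normc_root_le_hardy_norm {R : realType} {T : tree} {p : R}
    {f : T -> R[i]} :
  p != 0 -> little_hardy R T p f ->
  Normc.normc (f (tree_root T)) <= hardy_norm R T p f.
Proof. by move=> p0 fH; rewrite -(mean0 _ _ p) // mean_le_hardy_norm. Qed.

Theorem proposition3p4p1 (R : realType) (p : R) (T : tree) :
  1 <= p ->
  bounded_operator_on (little_hardy R T p) (hardy_norm R T p) (forward_shift R T) ->
  ~ hypercyclic_on (little_hardy R T p) (hardy_norm R T p) (forward_shift R T).
Proof.
move=> p1 [SH _ _] [f fH dense].
have p0 : p != 0 by rewrite gt_eqF // (lt_le_trans ltr01).
pose c : R[i] := `|f (tree_root T)| + 1.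
have c_ge1 : 1 <= `|c| by rewrite ger0_norm ?addr_ge0 // lerDr.
have fc_ge1 : 1 <= `|f (tree_root T) - c|.
  rewrite distrC; apply: le_trans (lerB_dist _ _).
  by rewrite ger0_norm ?addr_ge0 // addrAC subrr add0r.
pose g : T -> R[i] := fun v => if v == tree_root T then c else 0.
have g0 v : v != tree_root T -> g v = 0 by rewrite /g => /negbTE ->.
have gH : little_hardy R T p g.
  apply: (@little_hardy_eq_off_root _ _ _ (fun=> 0)) => [v /g0 //|].
  rewrite /little_hardy /=.
  suff -> : (fun n => mean p n (fun _ : T => 0 : R[i])) = fun=> 0 by exact: cvg_cst.
  apply/funext => n; rewrite /mean fsbig1 ?mulr0 ?powR0 ?invr_eq0 // => v _.
  by rewrite Normc.normc0 powR0.
have [n] := dense g gH 1 ltr01; apply/negP; rewrite -leNgt.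
have SfH : little_hardy R T p (iter n (forward_shift R T) f).
  elim: n => [|n IHn]; first exact: fH.
  by rewrite iterS; exact: SH IHn.
have dH : little_hardy R T p (iter n (forward_shift R T) f - g).
  apply: little_hardy_eq_off_root SfH => v /g0 gv.
  by rewrite !fctE gv subr0.
apply: le_trans (normc_root_le_hardy_norm p0 dH).
(* pass from the real-valued modulus to the norm of [R[i]] *)
rewrite -lecR -[(Normc.normc _)%:C%C]/(`| _ : R[i]|).
rewrite !fctE /g eqxx; case: n {SfH dH} => [//|n] /=.
by rewrite {1}/forward_shift eqxx sub0r normrN.
Qed.
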